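(* Let $n\ge1$, let $C\subseteq\mathbb{CP}^1$ be projectively convex, and let $\phi\in\mathrm{SL}_2(\mathbb{C})$. If the pole of $\phi$ is in $C$, then the polar derivative $d_\phi:V(n)\to V(n-1)$ preserves strong $C$-stability: for every $C$-stable $p\in V(n)$, $d_\phi p$ is nonzero and $C$-stable.
   Context: $V(n)$ is the space of complex homogeneous polynomials of degree $n$ in $x,y$. $\mathbb{CP}^1\ni(a:b)$ is identified with the Riemann sphere $\mathbb{C}\cup\{\infty\}$ via $a/b$. For $C\subseteq\mathbb{CP}^1$, $p\in V(n)$ is $C$-stable if $p$ has no zero in $C$. $\mathrm{SL}_2(\mathbb{C})$ acts on $\mathbb{CP}^1$ by M\''obius transformations (matrix multiplication on $\binom{a}{b}$) and on $V(n)$ by $(\phi\cdot p)(x,y)=p(\phi^{-1}\binom{x}{y})$. The pole of $\phi=\begin{pmatrix}a&b\\c&d\end{pmatrix}$ is $(-d:c)\in\mathbb{CP}^1$, the point sent to $\infty$ by $\phi$. The polar derivative with respect to $\phi$ is $d_\phi p:=(\phi^{-1}\partial_x\phi)p=-(-d\,\partial_x+c\,\partial_y)p$. A set $C\subseteq\mathbb{CP}^1$ is projectively convex if for every $\phi\in\mathrm{SL}_2(\mathbb{C})$ whose pole is not in $C$, the set $\phi\cdot C\subseteq\mathbb{C}$ is convex. *)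

(* Defs.v *)
From HB Require Import structures.
From mathcomp Require Import all_boot all_order all_algebra.
From mathcomp Require Import generic_quotient.
From mathcomp Require Import boolp classical_sets reals convex.
From mathcomp Require Import mpoly complex ring.

Set Implicit Arguments.
Unset Strict Implicit.
Unset Printing Implicit Defensive.

Import Order.TTheory GRing.Theory Num.Theory.

Local Open Scope ring_scope.
Local Open Scope quotient_scope.
Local Open Scope classical_set_scope.

Section ProjectiveLine.
Variable F : fieldType.

Definition vec2 (a b : F) : 'cV[F]_2 := \col_i (if i == 0 then a else b).

Definition nzvec := {v : 'cV[F]_2 | v != 0}.

Definition proportional (u v : nzvec) : bool :=
  `[< exists2 k : F, k != 0 & val v = k *: val u >].

Lemma proportional_refl : reflexive proportional.
Proof. by move=> u; apply/asboolP; exists 1; rewrite ?oner_eq0 ?scale1r. Qed.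

Lemma proportional_sym : ssrbool.symmetric proportional.
Proof.
have H u v : proportional u v -> proportional v u.
  move=> /asboolP[k k0 e]; apply/asboolP; exists k^-1; first by rewrite invr_eq0.
  by rewrite e scalerA mulVf // scale1r.
by move=> u v; apply/idP/idP; apply: H.
Qed.

Lemma proportional_trans : transitive proportional.
Proof.
move=> v u w /asboolP[k k0 e] /asboolP[l l0 e']; apply/asboolP.
by exists (l * k); rewrite ?mulf_neq0 // e' e scalerA.
Qed.

Canonical proportional_equiv :=
  EquivRel proportional proportional_refl proportional_sym proportional_trans.

Definition projline := {eq_quot proportional}.

Lemma vec2_10_neq0 : vec2 1 0 != 0.
Proof.
by apply/eqP => /matrixP /(_ 0 0) /eqP; rewrite !mxE /= oner_eq0.
Qed.

(* The point (v 0 : v 1) of the projective line; the zero vector, which is not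
   in the domain of this map, is sent to the junk value (1 : 0). *)
Definition point (v : 'cV[F]_2) : projline :=
  \pi_projline (insubd (Sub (vec2 1 0) vec2_10_neq0 : nzvec) v).

Definition coords (x : projline) : 'cV[F]_2 := val (repr x).

(* The affine chart: z is identified with (z : 1), and infinity is (1 : 0). *)
Definition embed (z : F) : projline := point (vec2 z 1).

Definition mobius (phi : 'M[F]_2) (x : projline) : projline :=
  point (phi *m coords x).

Definition pole (phi : 'M[F]_2) : projline :=
  point (vec2 (- phi 1 1) (phi 1 0)).

Definition pact (phi : 'M[F]_2) (p : {mpoly F[2]}) : {mpoly F[2]} :=
  p \mPo [tuple \sum_(j < 2) invmx phi i j *: 'X_j | i < 2].

(* The partial derivative is with respect to x, that is 'X_0. *)
Definition polar_deriv (phi : 'M[F]_2) (p : {mpoly F[2]}) : {mpoly F[2]} :=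
  pact (invmx phi) (mderiv 0 (pact phi p)).

(* For homogeneous p, being zero at a point does not depend on the choice of
   homogeneous coordinates (lemma zero_at_point below). *)
Definition zero_at (p : {mpoly F[2]}) (x : projline) : Prop :=
  p.@[fun i => coords x i 0] = 0.

Definition stable (C : set projline) (p : {mpoly F[2]}) : Prop :=
  forall x, C x -> ~ zero_at p x.

End ProjectiveLine.

(* [Rcomplex R] is R[i] seen as a vector space over R, so that [convex_set] is
   the usual, real, notion of convexity in the plane. When the pole of phi is
   not in C, phi(C) does not contain infinity, so that its trace on the affine
   chart is the whole of it. *)
Definition projectively_convex (R : realType) (C : set (projline R[i])) : Prop :=
  forall phi : 'M[R[i]]_2, \det phi = 1 -> ~ C (pole phi) ->
    convex_set ([set z | (mobius phi @` C) (embed z)] : set (Rcomplex R)).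

Section Facts.
Variable F : fieldType.

Lemma coords_neq0 (x : projline F) : coords x != 0.
Proof. exact: (valP (repr x)). Qed.

Lemma pointK (x : projline F) : point (coords x) = x.
Proof. by rewrite /point /coords valKd reprK. Qed.

Lemma coords_point (v : 'cV[F]_2) : v != 0 ->
  exists2 k, k != 0 & coords (point v) = k *: v.
Proof.
move=> v0; have : point v = point v by [].
rewrite -{1}(pointK (point v)) /point /coords valKd.
move=> /eqmodP; rewrite /= proportional_sym => /asboolP[k k0 ->].
by exists k => //; rewrite insubdK.
Qed.

Lemma pointZ (k : F) (v : 'cV[F]_2) : k != 0 -> v != 0 ->
  point (k *: v) = point v.
Proof.
move=> k0 v0; apply/eqmodP; rewrite /= proportional_sym; apply/asboolP.
exists k => //; rewrite !insubdK //.
by rewrite -topredE /= scaler_eq0 negb_or k0.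
Qed.

Lemma mobius_point (phi : 'M[F]_2) (v : 'cV[F]_2) : \det phi = 1 -> v != 0 ->
  mobius phi (point v) = point (phi *m v).
Proof.
move=> dphi v0; rewrite /mobius; have [k k0 ->] := coords_point v0.
rewrite -scalemxAr pointZ //; apply: contra v0 => /eqP /(congr1 (mulmx (invmx phi))).
by rewrite mulKmx ?mulmx0 ?unitmxE ?dphi ?unitr1 // => ->.
Qed.

Lemma lift00 : lift 0 0 = 1 :> 'I_2.
Proof. exact/val_inj. Qed.

Lemma det2 (A : 'M[F]_2) : \det A = A 0 0 * A 1 1 - A 0 1 * A 1 0.
Proof.
rewrite (expand_det_row _ 0) !big_ord_recl big_ord0 /cofactor !det_mx11 !mxE lift00.
have -> : lift 1 0 = 0 :> 'I_2 by apply/val_inj.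
by rewrite /= addr0 expr0 expr1 mul1r mulN1r mulrN.
Qed.

Lemma mobius_pole (phi : 'M[F]_2) : \det phi = 1 ->
  mobius phi (pole phi) = point (vec2 1 0).
Proof.
move=> dphi.
have e : phi *m vec2 (- phi 1 1) (phi 1 0) = (-1) *: vec2 1 0.
  apply/colP => i; rewrite !mxE !big_ord_recl big_ord0 !mxE /=.
  rewrite lift00 addr0; case: (eqVneq i 0) => [->|i0].
    rewrite mulr1 -dphi det2; ring.
  have -> : i = 1 by apply/val_inj; case: i i0 => [[|[|]]].
  ring.
have v0 : vec2 (- phi 1 1) (phi 1 0) != 0.
  apply: contra_eq_neq e => ->; rewrite mulmx0 eq_sym scaler_eq0 oppr_eq0.
  by rewrite oner_eq0 vec2_10_neq0.
by rewrite mobius_point // e pointZ ?vec2_10_neq0 // oppr_eq0 oner_eq0.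
Qed.

Lemma zero_at_point (n : nat) (p : {mpoly F[2]}) (v : 'cV[F]_2) :
  p \is n.-homog -> v != 0 ->
  zero_at p (point v) <-> p.@[fun i => v i 0] = 0.
Proof.
move=> hp v0; rewrite /zero_at; have [k k0 ->] := coords_point v0.
have -> : p.@[fun i => (k *: v) i 0] = k ^+ n * p.@[fun i => v i 0].
  rewrite !mevalE mulr_sumr; apply: eq_big_seq => m /(dhomog_mf hp) <-.
  rewrite mulrCA; congr (_ * _).
  rewrite /= mdegE -prodrXr -big_split /=; apply: eq_bigr => i _.
  by rewrite mxE exprMn.
split=> [/eqP|->]; last by rewrite mulr0.
by rewrite mulf_eq0 expf_eq0 (negPf k0) andbF => /eqP.
Qed.

Lemma mpoly_gen_ind (P : {mpoly F[2]} -> Prop) :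
  (forall c, P c%:MP) -> (forall i, P 'X_i) ->
  (forall p q, P p -> P q -> P (p + q)) ->
  (forall p q, P p -> P q -> P (p * q)) -> forall p, P p.
Proof.
move=> PC PX PD PM p; rewrite (mpolyE p).
apply: big_ind => [||m _]; [by rewrite -mpolyC0 | by [] |].
rewrite -mul_mpolyC; apply: (PM _ _ (PC _)); rewrite mpolyXE_id.
apply: big_ind => [||i _]; [exact: PC | by [] |].
elim: (m i) => [|k IH]; first by rewrite expr0; exact: PC.
by rewrite exprS; apply: PM.
Qed.

Lemma pactX (phi : 'M[F]_2) (i : 'I_2) :
  pact phi 'X_i = \sum_(j < 2) invmx phi i j *: 'X_j.
Proof. by rewrite /pact comp_mpolyXU -tnth_nth tnth_mktuple. Qed.

Lemma pactM (phi : 'M[F]_2) : {morph pact phi : p q / p * q}.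
Proof. by move=> p q; rewrite /pact rmorphM. Qed.

Lemma mderiv_pact (phi : 'M[F]_2) (p : {mpoly F[2]}) (j : 'I_2) :
  mderiv j (pact phi p) = \sum_(i < 2) invmx phi i j *: pact phi (mderiv i p).
Proof.
elim/mpoly_gen_ind: p => [c|i|p q IHp IHq|p q IHp IHq].
- rewrite /pact comp_mpolyC mderivC big1 // => i _.
  by rewrite mderivC comp_mpoly0 scaler0.
- have dX (a b : 'I_2) : mderiv a 'X_b = (a == b)%:R :> {mpoly F[2]}.
    rewrite mderivX mnm1E eq_sym; case: eqVneq => [->|_]; last by rewrite scale0r.
    by rewrite -{1}[U_(b)%MM]add0m addmK mpolyX0 scale1r.
  rewrite pactX raddf_sum /= (bigD1 j) //= big1 => [|k kj]; last first.
    by rewrite mderivZ dX eq_sym (negPf kj) scaler0.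
  rewrite (bigD1 i) //= big1 => [|k kj]; last first.
    by rewrite dX (negPf kj) /pact comp_mpoly0 scaler0.
  by rewrite mderivZ !dX !eqxx /pact comp_mpoly1.
- rewrite /pact !raddfD /= -!/(pact _ _) IHp IHq -big_split /=.
  by apply: eq_bigr => i _; rewrite mderivD /pact raddfD scalerDr.
- rewrite pactM mderivM IHp IHq mulr_suml mulr_sumr -big_split /=.
  apply: eq_bigr => i _; rewrite mderivM /pact raddfD /= -!/(pact _ _) !pactM.
  by rewrite -scalerAl -scalerAr scalerDr.
Qed.

Lemma pactK (phi : 'M[F]_2) (p : {mpoly F[2]}) : phi \in unitmx ->
  pact (invmx phi) (pact phi p) = p.
Proof.
move=> uphi; elim/mpoly_gen_ind: p => [c|i|p q IHp IHq|p q IHp IHq].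
- by rewrite /pact !comp_mpolyC.
- rewrite pactX /pact raddf_sum /= -/(pact _ _).
  under eq_bigr => j _ do
    rewrite comp_mpolyZ -/(pact _ _) pactX invmxK scaler_sumr.
  rewrite exchange_big /=.
  under eq_bigr => k _ do under eq_bigr => j _ do rewrite scalerA.
  have e k : \sum_(j < 2) invmx phi i j * phi j k = (i == k)%:R.
    by have /matrixP/(_ i k) := mulVmx uphi; rewrite !mxE.
  under eq_bigr => k _ do rewrite -scaler_suml e.
  rewrite (bigD1 i) //= big1 => [|k ki]; first by rewrite eqxx scale1r addr0.
  by rewrite eq_sym (negPf ki) scale0r.
- by rewrite /pact !raddfD /= -!/(pact _ _) IHp IHq.
- by rewrite !pactM IHp IHq.
Qed.

Lemma polar_derivE (phi : 'M[F]_2) (p : {mpoly F[2]}) : \det phi = 1 ->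
  polar_deriv phi p =
    - (- phi 1 1 *: mderiv 0 p + phi 1 0 *: mderiv 1 p).
Proof.
move=> dphi; have uphi : phi \in unitmx by rewrite unitmxE dphi unitr1.
rewrite /polar_deriv mderiv_pact /pact raddf_sum /=.
under eq_bigr => i _ do rewrite comp_mpolyZ -!/(pact _ _) pactK //.
rewrite !big_ord_recl big_ord0 addr0 lift00.
have [-> ->] : invmx phi 0 0 = phi 1 1 /\ invmx phi 1 0 = - phi 1 0.
  have h := mulVmx uphi.
  have /matrixP/(_ 0 0) := h; have /matrixP/(_ 1 0) := h; move: (dphi).
  have /matrixP/(_ 0 1) := h; have /matrixP/(_ 1 1) := h.
  rewrite !mxE !big_ord_recl !big_ord0 lift00 det2 /= => h11 h01 d h10 h00.
  split.
    rewrite -[LHS]mulr1 -d.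
    transitivity (phi 1 1 * (invmx phi 0 0 * phi 0 0 + (invmx phi 0 1 * phi 1 0 + 0))
      - phi 1 0 * (invmx phi 0 0 * phi 0 1 + (invmx phi 0 1 * phi 1 1 + 0))).
      ring.
    by rewrite h00 h01 mulr0 mulr1 subr0.
  rewrite -[LHS]mulr1 -d.
  transitivity (phi 1 1 * (invmx phi 1 0 * phi 0 0 + (invmx phi 1 1 * phi 1 0 + 0))
    - phi 1 0 * (invmx phi 1 0 * phi 0 1 + (invmx phi 1 1 * phi 1 1 + 0))).
    ring.
  by rewrite h10 h11 mulr0 mulr1 sub0r.
by rewrite opprD !scaleNr opprK.
Qed.

End Facts.

(* Main.v *)
(* Let v represent the pole and suppose d_phi p, which is minus the derivative
   of p along v, vanishes at a point w of C; Euler's identity excludes w = v.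
   The roots z of t |-> p(w + t v), a polynomial of degree n, are nonzero and
   the logarithmic derivative at 0 gives \sum 1/z = 0. In the coordinate s of
   the points s w + v, the zeros 1/z of p thus lie outside C and have mean 0,
   while C contains both 0 (the pole) and infinity (w). As C contains infinity,
   its complement is an affine convex set, so the mean 0 is outside C: a
   contradiction. *)
Require Import Defs.
From mathcomp Require Import all_boot all_order all_algebra.
From mathcomp Require Import boolp classical_sets reals convex.
From mathcomp Require Import interval_inference mpoly complex ring.

Set Implicit Arguments.
Unset Strict Implicit.
Unset Printing Implicit Defensive.

Import Order.TTheory GRing.Theory Num.Theory.

Local Open Scope ring_scope.

(** * Homogeneous polynomials: Euler's identity and restriction to a line *)

Section MpolyHomog.
Variables (F : fieldType) (k : nat).
Implicit Types (p : {mpoly F[k]}) (v w : 'I_k -> F).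

Lemma mderiv_homog n p i : p \is n.-homog -> mderiv i p \is n.-1.-homog.
Proof.
move=> hp; rewrite /mderiv big_seq; apply: rpred_sum => m mp.
have [->|mi] := posnP (m i); first by rewrite mul0r scale0r rpred0.
apply: rpredZ; rewrite dhomogX /= -(dhomog_mf hp mp) /=.
have mU : (U_(i) <= m)%MM by rewrite lep1mP -lt0n.
by rewrite -[in eqbRHS](submK mU) mdegD mdeg1 addn1.
Qed.

(** The operator ['X_i * mderiv i] multiplies a monomial by its exponent at [i], and these exponents
    sum to [n]. *)
Lemma euler_homog n p : p \is n.-homog ->
  \sum_i 'X_i * mderiv i p = n%:R *: p.
Proof.
move=> hp; rewrite [p in RHS]mpolyE scaler_sumr.
under eq_bigr => i _ do rewrite /mderiv mulr_sumr.
rewrite exchange_big /=; apply: eq_big_seq => m mp.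
have <- := dhomog_mf hp mp; rewrite /= mdegE natr_sum scaler_suml.
apply: eq_bigr => i _; rewrite scalerA -scalerAr.
have [->|mi] := posnP (m i); first by rewrite mul0r !scale0r.
by rewrite -mpolyXD addmC submK // lep1mP -lt0n.
Qed.

(** The restriction t |-> p(w + t v), kept as a formal polynomial so that its roots and coefficients
    are available. *)
Definition line_poly w v p : {poly F} :=
  mmap polyC (fun i => (w i)%:P + v i *: 'X) p.

Lemma horner_line_poly w v p t :
  (line_poly w v p).[t] = p.@[fun i => w i + t * v i].
Proof.
rewrite /line_poly /mmap horner_sum mevalE; apply: eq_bigr => m _.
rewrite hornerM hornerC /mmap1 horner_prod; congr (_ * _).
by apply: eq_bigr => i _; rewrite !hornerE mulrC.
Qed.

(** Sizes are only bounded, since a top coefficient may vanish. In the convolution, an index below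
    [a] kills the factor from [B] and one above [a] kills the factor from [A]. *)
Lemma size_coefM (A B : {poly F}) a b :
  (size A <= a.+1)%N -> (size B <= b.+1)%N ->
  (size (A * B)%R <= (a + b).+1)%N /\ (A * B)`_(a + b) = A`_a * B`_b.
Proof.
move=> hA hB; split.
  apply: leq_trans (size_polyMleq A B) _.
  by rewrite -subn1 leq_subLR add1n -addnS -addSn leq_add.
have hle : (a < (a + b).+1)%N by rewrite ltnS leq_addr.
rewrite coefM (bigD1 (Ordinal hle)) //= addKn big1 ?addr0 // => i.
rewrite -val_eqE /= neq_ltn => /orP[] hi.
  rewrite [B`_ _]nth_default ?mulr0 //; apply: leq_trans hB _.
  by rewrite ltn_subRL ltn_add2r.
by rewrite nth_default ?mul0r // (leq_trans hA).
Qed.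

Lemma size_coef_exp (A : {poly F}) e : (size A <= 2)%N ->
  (size (A ^+ e)%R <= e.+1)%N /\ (A ^+ e)`_e = A`_1 ^+ e.
Proof.
move=> hA; elim: e => [|e [IHs IHc]]; first by rewrite !expr0 size_poly1 coef1.
by have := size_coefM hA IHs; rewrite IHc -!exprS add1n.
Qed.

Lemma size_coef_prod (A : 'I_k -> {poly F}) (e : 'I_k -> nat) :
  (forall i, (size (A i) <= (e i).+1)%N) ->
  (size (\prod_i A i)%R <= (\sum_i e i).+1)%N /\
  (\prod_i A i)`_(\sum_i e i) = \prod_i (A i)`_(e i).
Proof.
move=> hA; elim/big_rec3: _ => [|i c n B _ [sB <-]].
  by rewrite size_poly1 coef1.
exact: size_coefM.
Qed.

(** In a monomial of degree [n], the coefficient of t^n takes the term v_i t from every factor w_i +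
    t v_i. *)
Lemma coef_line_poly n w v p : p \is n.-homog ->
  (line_poly w v p)`_n = p.@[v].
Proof.
move=> hp; rewrite /line_poly; set L := fun i => _.
have sL i : (size (L i) <= 2)%N.
  rewrite (leq_trans (size_polyD _ _)) // geq_max.
  rewrite (leq_trans (size_polyC_leq1 _)) //.
  by rewrite (leq_trans (size_scale_leq _ _)) ?size_polyX.
rewrite /mmap coef_sum mevalE; apply: eq_big_seq => m mp.
rewrite coefCM -(dhomog_mf hp mp) /= mdegE /mmap1; congr (_ * _).
have [i|_ ->] := @size_coef_prod (fun i => L i ^+ m i) m.
  by have [] := size_coef_exp (m i) (sL i).
apply: eq_bigr => i _; have [_ ->] := size_coef_exp (m i) (sL i).
by rewrite coefD coefC coefZ coefX add0r mulr1.
Qed.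

End MpolyHomog.

(** * Derivatives at 0, sums over roots, and means *)

Lemma deriv_line_poly (F : fieldType) (w v : 'I_2 -> F) (p : {mpoly F[2]}) :
  ((line_poly w v p)^`()).[0] = \sum_i v i * (mderiv i p).@[w].
Proof.
have h0 q : (line_poly w v q).[0] = q.@[w].
  rewrite horner_line_poly; apply: meval_eq => i; ring.
rewrite /line_poly in h0 *.
(* Both sides are additive and obey the same Leibniz rule, so constants and variables suffice. *)
elim/mpoly_gen_ind: p => [c|i|p q IHp IHq|p q IHp IHq].
- rewrite mmapC derivC horner0 big1 // => i _.
  by rewrite mderivC meval0 mulr0.
- rewrite mmapX mmap1U derivD derivC derivZ derivX !hornerE.
  rewrite (bigD1 i) //= big1 => [|j ji].
    by rewrite mderivX mnm1E eqxx -{1}[U_(i)%MM]add0m addmK mpolyX0 scale1r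
      meval1 mulr1 addr0.
  by rewrite mderivX mnm1E eq_sym (negPf ji) scale0r meval0 mulr0.
- rewrite mmapD derivD hornerD IHp IHq -big_split; apply: eq_bigr => i _.
  by rewrite mderivD mevalD mulrDr.
- rewrite rmorphM derivM hornerD !hornerM IHp IHq !h0 mulr_suml mulr_sumr.
  rewrite -big_split; apply: eq_bigr => i _.
  by rewrite mderivM mevalD !mevalM /=; ring.
Qed.

(** The logarithmic derivative of ['X - z%:P] at 0 is -1/z; the value at 0 is multiplied out. *)
Lemma deriv_prod_XsubC0 (F : fieldType) (r : seq F) : 0 \notin r ->
  ((\prod_(z <- r) ('X - z%:P))^`()).[0] =
  - (\prod_(z <- r) ('X - z%:P)).[0] * \sum_(z <- r) z^-1.
Proof.
elim: r => [|z r IH]; first by rewrite !big_nil derivC horner0 mulr0.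
rewrite inE negb_or eq_sym => /andP[z0 /IH {}IH].
rewrite !big_cons derivM derivXsubC hornerD !hornerM IH !hornerE /=.
by field.
Qed.

Lemma mean_convex_closed (R : realType) (D : R[i] -> Prop) (s : seq R[i]) :
  (forall a b (l : R), D a -> D b -> 0 <= l <= 1 ->
     D (l%:C%C * a + (1 - l%:C%C) * b)) ->
  s != [::] -> (forall z, z \in s -> D z) ->
  D (\sum_(z <- s) z / (size s)%:R).
Proof.
move=> cD; elim: s => // a [|b s] IH _ hs.
  by rewrite big_seq1 divr1; apply: hs; rewrite inE.
have {}IH : D (\sum_(z <- b :: s) z / (size (b :: s))%:R).
  by apply: IH => // z zs; apply: hs; rewrite inE zs orbT.
(* The new element [a] gets weight 1/N, where N is the new length; the previous mean gets 1 -
   1/N. *)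
have := cD _ _ ((size [:: a, b & s])%:R^-1) (hs a (mem_head _ _)) IH.
rewrite invr_ge0 ler0n invf_le1 ?ltr0n // ler1n => /(_ isT).
congr D; rewrite fmorphV rmorph_nat [in RHS]big_cons /= -!mulr_suml.
set S := \sum_(z <- _) _; rewrite (natrD _ 1 (size s).+1).
have n0 : (size s).+1%:R != 0 :> R[i] by rewrite pnatr_eq0.
have n1 : 1 + (size s).+1%:R != 0 :> R[i] by rewrite nat1r pnatr_eq0.
by move: (size s).+1%:R n0 n1 => N n0 n1; field; rewrite n0 n1.
Qed.

(** * Charts of the projective line and the polar derivative in coordinates *)

Section ProjectiveLineCharts.
Variable F : fieldType.
Implicit Types u v w : 'cV[F]_2.

Lemma vec2E u : u = vec2 (u 0 0) (u 1 0).
Proof.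
apply/colP => i; rewrite mxE; case: eqVneq => [->//|i0]; congr (u _ _).
by apply/val_inj; case: i i0 => [[|[|]]].
Qed.

Lemma vec2_1_neq0 (z : F) : vec2 z 1 != 0.
Proof. by apply/eqP => /matrixP /(_ 1 0) /eqP; rewrite !mxE /= oner_eq0. Qed.

Lemma pole_vec_neq0 (phi : 'M[F]_2) : \det phi = 1 ->
  vec2 (- phi 1 1) (phi 1 0) != 0.
Proof.
move=> dphi; apply/eqP => /matrixP v0.
have := v0 0 0; have := v0 1 0; rewrite !mxE /=.
move=> e0 /eqP; rewrite oppr_eq0 => /eqP e1.
by have /eqP := dphi; rewrite det2 e0 e1 !mulr0 subrr eq_sym oner_eq0.
Qed.

(** For nonzero vectors, this determinant vanishes exactly when both represent the same point. *)
Definition det_vec u v : F := u 0 0 * v 1 0 - u 1 0 * v 0 0.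

Lemma det_vec_eq0 u v : u != 0 -> det_vec u v = 0 -> exists k, v = k *: u.
Proof.
move=> u0 /eqP; rewrite subr_eq0 => /eqP d0.
have [e|a0] := eqVneq (u 0 0) 0; last first.
  exists (v 0 0 / u 0 0); rewrite [LHS]vec2E [in RHS](vec2E u).
  apply/colP => i; rewrite !mxE /=; case: ifP => _; first by rewrite divfK.
  by apply: (mulfI a0); rewrite d0; field.
have a1 : u 1 0 != 0.
  apply: contra_neq u0 => e1; rewrite (vec2E u) e e1.
  by apply/colP => i; rewrite !mxE if_same.
exists (v 1 0 / u 1 0); rewrite [LHS]vec2E [in RHS](vec2E u).
apply/colP => i; rewrite !mxE /=; case: ifP => _; last by rewrite divfK.
by apply: (mulfI a1); rewrite -d0; field.
Qed.

(** Adding a multiple of [w] to [v] does not change the determinant with [w]. *)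
Lemma line_neq0 w v (s : F) : det_vec w v != 0 -> s *: w + v != 0.
Proof.
apply: contra_neq => e; transitivity (det_vec w (s *: w + v)).
  by rewrite /det_vec !mxE; ring.
by rewrite e /det_vec !mxE; ring.
Qed.

Lemma mobius_inj (phi : 'M[F]_2) : \det phi = 1 -> injective (mobius phi).
Proof.
move=> dphi; have uphi : phi \in unitmx by rewrite unitmxE dphi unitr1.
apply: (can_inj (g := mobius (invmx phi))) => x.
have xn0 : phi *m coords x != 0.
  apply: contra (coords_neq0 x) => /eqP e.
  by rewrite -(mulKmx uphi (coords x)) e mulmx0.
rewrite {2}/mobius mobius_point ?det_inv ?dphi ?invr1 //.
by rewrite mulKmx // pointK.
Qed.

(* In the coordinate s of the points s w + v, for which w is at infinity, the
   transformation is s |-> 1 / ((a - s) det (w, v)). *)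
Lemma mobius_at w v (a : F) : det_vec w v != 0 ->
  exists phi : 'M[F]_2,
    [/\ \det phi = 1, pole phi = Defs.point (a *: w + v),
        mobius phi (Defs.point w) = embed 0
      & forall s, a != s -> mobius phi (Defs.point (s *: w + v)) =
          embed (((a - s) * det_vec w v)^-1)].
Proof.
move=> d0; pose D := det_vec w v.
(* The rows are the linear forms vanishing at [w], which is sent to 0, and at [a *: w + v], which is
   the pole. Dividing the first by [D] makes the determinant 1. *)
pose phi : 'M[F]_2 := \matrix_(i, j)
  if i == 0 then (if j == 0 then - w 1 0 else w 0 0) / D
  else (if j == 0 then - (a * w 1 0 + v 1 0) else a * w 0 0 + v 0 0).
have dphi : \det phi = 1 by rewrite det2 !mxE /= /D /det_vec; field.
have phiE u : phi *m u = vec2 (det_vec w u / D) (det_vec (a *: w + v) u).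
  apply/colP => i; rewrite !mxE !big_ord_recl big_ord0 !mxE lift00 addr0.
  by case: (i == 0); rewrite /= -?[ord0]/(0 : 'I_2) /D /det_vec ?mxE; field.
exists phi; split=> // [||s as0].
- rewrite -(pointZ (k := -1)) ?oppr_eq0 ?oner_eq0 ?line_neq0 //.
  congr Defs.point; rewrite [a *: w + v]vec2E; apply/colP => i; rewrite !mxE /=.
  by case: ifP => _; ring.
- have w0 : w != 0 by apply: contra_neq d0 => ->; rewrite /det_vec !mxE; ring.
  rewrite mobius_point // phiE.
  have -> : det_vec w w = 0 by rewrite /det_vec; ring.
  have -> : det_vec (a *: w + v) w = - D by rewrite /D /det_vec !mxE; ring.
  rewrite mul0r /embed -[RHS](pointZ (k := - D)) ?oppr_eq0 ?vec2_1_neq0 //.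
  congr Defs.point; apply/colP => i; rewrite !mxE.
  by case: ifP => _; rewrite ?mulr0 ?mulr1.
have as1 : a - s != 0 by rewrite subr_eq0.
have sD0 : (a - s) * D != 0 by rewrite mulf_neq0.
rewrite mobius_point ?line_neq0 // phiE.
have -> : det_vec w (s *: w + v) = D by rewrite /D /det_vec !mxE; ring.
have -> : det_vec (a *: w + v) (s *: w + v) = (a - s) * D.
  by rewrite /D /det_vec !mxE; ring.
rewrite divff // /embed -[RHS](pointZ sD0) ?vec2_1_neq0 //.
congr Defs.point; apply/colP => i; rewrite !mxE.
by case: ifP => _; rewrite ?mulr1 // divff.
Qed.

Lemma polar_deriv_homog (phi : 'M[F]_2) n (p : {mpoly F[2]}) :
  \det phi = 1 -> p \is n.-homog -> polar_deriv phi p \is n.-1.-homog.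
Proof.
by move=> *; rewrite polar_derivE // rpredN rpredD // rpredZ // mderiv_homog.
Qed.

Lemma meval_polar_deriv (phi : 'M[F]_2) (p : {mpoly F[2]}) (w : 'I_2 -> F) :
  \det phi = 1 -> (polar_deriv phi p).@[w] =
  - \sum_i vec2 (- phi 1 1) (phi 1 0) i 0 * (mderiv i p).@[w].
Proof.
move=> dphi; rewrite polar_derivE // mevalN mevalD !mevalZ.
by rewrite !big_ord_recl big_ord0 addr0 lift00 !mxE.
Qed.

(** At [v] itself the derivative along [v] is radial, so Euler's identity evaluates it. *)
Lemma polar_deriv_pole (phi : 'M[F]_2) n (p : {mpoly F[2]})
    (v := vec2 (- phi 1 1) (phi 1 0)) :
  \det phi = 1 -> p \is n.-homog ->
  (polar_deriv phi p).@[fun i => v i 0] = - (n%:R * p.@[fun i => v i 0]).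
Proof.
move=> dphi hp; rewrite meval_polar_deriv // -mevalZ -(euler_homog hp).
congr (- _); rewrite raddf_sum /=; apply: eq_bigr => i _.
by rewrite mevalM mevalXU.
Qed.

End ProjectiveLineCharts.

(** * Convexity of the complement in an affine chart *)

Lemma scale_RcomplexE (R : realType) (k : R) (z : Rcomplex R) :
  k *: z = (k%:C%C * z : R[i]).
Proof.
by case: z => x y; apply/eqP; rewrite eq_complex /= !mul0r subr0 addr0 !eqxx.
Qed.

(* If c lies strictly between a and b, then w, c, b and a are in this order on
   a circle, so in a chart sending a to infinity, b is between w and c. *)
Lemma projectively_convex_compl (R : realType) (C : set (projline R[i]))
    (w v : 'cV[R[i]]_2) :
  projectively_convex C -> det_vec w v != 0 -> C (Defs.point w) ->
  forall a b (l : R),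
    ~ C (Defs.point (a *: w + v)) -> ~ C (Defs.point (b *: w + v)) ->
    0 <= l <= 1 ->
    ~ C (Defs.point ((l%:C%C * a + (1 - l%:C%C) * b) *: w + v)).
Proof.
move=> hC d0 Cw a b l Ca Cb /andP[l0 l1] Cc.
have [eab|nab] := eqVneq a b.
  apply: Ca; suff -> : a = l%:C%C * a + (1 - l%:C%C) * b by [].
  by rewrite -eab; ring.
(* If [l] is 1, the combination is [a] itself; otherwise it differs from the pole [a] of the chart
   below. *)
have [el|nl] := eqVneq l 1.
  by apply: Ca; move: Cc; rewrite el subrr mul0r addr0 mul1r.
set c := l%:C%C * a + _ in Cc.
have nl' : 1 - l%:C%C != 0.
  by rewrite subr_eq0 -(rmorph1 (real_complex R)) (inj_eq (@complexI _)) eq_sym.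
have ac : a - c = (1 - l%:C%C) * (a - b) by rewrite /c; ring.
have nac : a != c.
  by rewrite -subr_eq0 ac; apply: mulf_neq0 nl' _; rewrite subr_eq0.
have [phi [dphi pole_phi phi_w phi_line]] := mobius_at a d0.
have Apole : ~ C (pole phi).
  rewrite pole_phi; exact: Ca.
have cl0 : 0 <= 1 - l by rewrite subr_ge0.
have cl1 : 1 - l <= 1 by rewrite gerBl.
(* Since a - c = (1 - l)(a - b), giving the image of [c] weight 1 - l and the image 0 of [w] weight
   l yields the image of [b]. *)
have := hC phi dphi Apole ((a - c) * det_vec w v)^-1 0 (Itv01 cl0 cl1).
rewrite !inE /= => h; have {h} [||x Cx] := h.
- by exists (Defs.point (c *: w + v)); [exact: Cc | exact: phi_line].
- by exists (Defs.point w); [exact: Cw | exact: phi_w].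
rewrite /conv /= scaler0 addr0 scale_RcomplexE rmorphB rmorph1.
have -> : (1 - l%:C%C) * ((a - c) * det_vec w v)^-1 =
    ((a - b) * det_vec w v)^-1 by rewrite ac -mulrA invfM mulVKf.
rewrite -(phi_line b nab) => /(mobius_inj dphi) xE.
by apply: Cb; rewrite -xE.
Qed.

(** * Nonvanishing of the polar derivative on [C] *)

Theorem proposition4p6 (R : realType) (n : nat) (hn : (1 <= n)%N)
    (C : set (projline R[i])) (hC : projectively_convex C)
    (phi : 'M[R[i]]_2) (hphi : \det phi = 1) (hpole : C (pole phi))
    (p : {mpoly R[i][2]}) (hp : p \is n.-homog) (hstable : stable C p) :
  [/\ polar_deriv phi p \is n.-1.-homog,
      polar_deriv phi p != 0
    & stable C (polar_deriv phi p)].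
Proof.
pose v := vec2 (- phi 1 1) (phi 1 0).
have v0 : v != 0 := pole_vec_neq0 hphi.
have hd := polar_deriv_homog hphi hp.
have pv : p.@[fun i => v i 0] != 0.
  by apply/eqP => /(zero_at_point hp v0); apply: hstable.
have dv : (polar_deriv phi p).@[fun i => v i 0] != 0.
  by rewrite (polar_deriv_pole hphi hp) oppr_eq0 mulf_neq0 // pnatr_eq0 -lt0n.
split=> //; first by apply: contra_neq dv => ->; rewrite meval0.
move=> x Cx; rewrite /zero_at; set w := coords x => dw.
have w0 : w != 0 := coords_neq0 x.
have xE : x = Defs.point w by rewrite pointK.
have pw : p.@[fun i => w i 0] != 0 by apply/eqP; apply: hstable Cx.
(* If the determinant is 0, then [x] is the pole, where the derivative is nonzero by [dv]. *)
have [d0|d0] := eqVneq (det_vec w v) 0.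
  have [k vE] := det_vec_eq0 w0 d0.
  have k0 : k != 0 by apply: contra_neq v0 => k0; rewrite vE k0 scale0r.
  move/negP: dv; apply; apply/eqP/(zero_at_point hd v0).
  by rewrite vE pointZ // -xE.
pose q := line_poly (fun i => w i 0) (fun i => v i 0) p.
have cq := coef_line_poly (fun i => w i 0) (fun i => v i 0) hp.
have [r qE] := closed_field_poly_normal q.
have q0 : q.[0] != 0.
  rewrite horner_line_poly; under meval_eq => i do rewrite mul0r addr0.
  exact: pw.
have rq z : z \in r -> root q z.
  rewrite -root_prod_XsubC => /rootP e.
  by rewrite qE rootE hornerZ e mulr0.
have r0 : 0 \notin r by apply: contra q0 => /rq.
(* Without roots [q] would be constant, but its coefficient of index [n], at least 1, is p(v). *)
have rn0 : r != [::].
  apply: contra_neq pv => r_nil; rewrite -cq -/q qE r_nil big_nil.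
  by rewrite coefZ coef1 eqn0Ngt hn mulr0.
(* Up to sign, q'(0) is the polar derivative at [w], which vanishes by [dw], while q(0) = p(w) is
   nonzero. *)
have sum0 : \sum_(z <- r) z^-1 = 0.
  have : q^`().[0] = 0.
    rewrite deriv_line_poly; apply/oppr_inj.
    by rewrite oppr0 -meval_polar_deriv.
  move: q0; rewrite qE derivZ !hornerZ deriv_prod_XsubC0 //.
  rewrite mulrA mulrN mulNr => /negPf h /eqP.
  by rewrite oppr_eq0 mulf_eq0 h => /eqP.
(* The vectors w + z v and z^-1 w + v represent the same point, a zero of [p]. *)
have Cr s : s \in [seq z^-1 | z <- r] -> ~ C (Defs.point (s *: w + v)).
  move=> /mapP[z zr ->] Cz.
  have z0 : z != 0 by apply: contraNneq r0 => <-.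
  apply: (hstable _ Cz).
  have -> : z^-1 *: w + v = z^-1 *: (w + z *: v).
    by rewrite scalerDr scalerA mulVf // scale1r.
  have wz0 : w + z *: v != 0.
    apply: contra_neq d0 => /eqP; rewrite addr_eq0 => /eqP ->.
    by rewrite /det_vec !mxE; ring.
  rewrite pointZ ?invr_eq0 //; apply/(zero_at_point hp wz0).
  have := rq z zr; rewrite rootE horner_line_poly => /eqP <-.
  by apply: meval_eq => i; rewrite !mxE.
have Cw : C (Defs.point w) by rewrite -xE.
have /= cC := projectively_convex_compl hC d0 Cw.
(* The mean of the inverse roots is 0, and the point with coordinate 0 is the pole, which lies in
   [C]. *)
have := mean_convex_closed (D := fun s => ~ C (Defs.point (s *: w + v))) _ _ Cr.
case; first by move=> a b l Ca Cb; apply: cC.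
  by case: (r) rn0.
by rewrite -mulr_suml big_map sum0 mul0r scale0r add0r.
Qed.
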